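(* Let $X$ be a finite set and $\Delta$ a nonempty abstract simplicial complex of $X$. Then $\Delta$ can be represented as the clique complex of a graph (equivalently, as the independence complex of a graph), i.e. there is a graph $H$ with $V(H)\subseteq X$ whose family of cliques (including $\emptyset$) is exactly $\Delta$, if and only if $\Delta$ satisfies the Median Property: for any $D_1,D_2,D_3\in\Delta$, $(D_1\cap D_2)\cup(D_1\cap D_3)\cup(D_2\cap D_3)\in\Delta$.
   Context: An abstract simplicial complex (ASC) of a set $X$ is a family $\Delta$ of subsets of $X$ such that $S\in\Delta$ and $S'\subseteq S$ imply $S'\in\Delta$. The clique complex of a graph $H$ is the family of all cliques of $H$ (sets of pairwise adjacent vertices, including the empty set); the independence complex is the family of all independent sets. The clique complex of $H$ equals the independence complex of the complement of $H$. *)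

(* Defs.v *)
From mathcomp Require Import all_boot.

Set Implicit Arguments.
Unset Strict Implicit.
Unset Printing Implicit Defensive.

Definition is_complex (X : finType) (D : {set {set X}}) : Prop :=
  forall S S' : {set X}, S \in D -> S' \subset S -> S' \in D.

(* A finite simple graph H with V(H) contained in X; V(H) may be a proper      *)
(* subset of X.                                                               *)
Record graph_in (X : finType) := GraphIn {
  vertices : {set X};
  adj : rel X;
  adj_sym : symmetric adj;
  adj_irr : irreflexive adj;
  adj_vertices : forall x y : X, adj x y -> (x \in vertices) && (y \in vertices)
}.

Definition is_clique (X : finType) (H : graph_in X) (S : {set X}) : bool :=
  (S \subset vertices H) &&
  [forall x in S, forall y in S, (x != y) ==> adj H x y].

Definition is_independent (X : finType) (H : graph_in X) (S : {set X}) : bool :=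
  (S \subset vertices H) &&
  [forall x in S, forall y in S, ~~ adj H x y].

Definition clique_complex (X : finType) (H : graph_in X) : {set {set X}} :=
  [set S | is_clique H S].

Definition independence_complex (X : finType) (H : graph_in X) :
    {set {set X}} :=
  [set S | is_independent H S].

Definition median_property (X : finType) (D : {set {set X}}) : Prop :=
  forall D1 D2 D3 : {set X}, D1 \in D -> D2 \in D -> D3 \in D ->
    (D1 :&: D2) :|: (D1 :&: D3) :|: (D2 :&: D3) \in D.

(* Main.v *)
(* Two points of the median of D1, D2, D3 each lie in two of the three sets,
   hence lie together in one of them; so the median of cliques is a clique.
   Conversely, the edges of H are forced to be the pairs in Delta.  If S has all
   its pairs in Delta and distinct elements x, y, z, then S is the median of
   S :\ x, S :\ y and S :\ z, so that S is in Delta by induction on #|S|. *)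
Require Import Defs.
From mathcomp Require Import all_boot.

(** Letting [x] and [y] coincide folds the condition [S \subset vertices H] into the pairwise
    one. *)
Lemma cliqueP (X : finType) (H : graph_in X) (S : {set X}) :
  reflect {in S &, forall x y, (x \in vertices H) && ((x == y) || adj H x y)}
          (is_clique H S).
Proof.
apply: (iffP andP) => [[/subsetP sSV /forall_inP cS] x y Sx Sy | cS].
  by rewrite sSV //= -implyNb; apply: (forall_inP (cS x Sx)).
split; first by apply/subsetP=> x Sx; have /andP[] := cS x x Sx Sx.
apply/forall_inP=> x Sx; apply/forall_inP=> y Sy.
by rewrite implyNb; have /andP[] := cS x y Sx Sy.
Qed.

Lemma clique_complex_median (X : finType) (H : graph_in X) :
  median_property (clique_complex H).
Proof.
move=> D1 D2 D3; rewrite !inE => /cliqueP c1 /cliqueP c2 /cliqueP c3.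
apply/cliqueP=> x y; rewrite !inE.
case x1: (x \in D1); case y1: (y \in D1); first by move=> _ _; apply: c1.
all: case x2: (x \in D2); case y2: (y \in D2); try by move=> _ _; apply: c2.
all: by case x3: (x \in D3); case y3: (y \in D3) => //= _ _; apply: c3.
Qed.

Lemma median_pairwise (X : finType) (D : {set {set X}}) (S : {set X}) :
  set0 \in D -> median_property D -> {in S &, forall x y, [set x; y] \in D} ->
  S \in D.
Proof.
move=> D0 medD; have [n] := ubnP #|S|; elim: n S => // n IHn S leSn pS.
have [->//|[x Sx]] := set_0Vmem S.
(* Base cases: the hypothesis on pairs allows equal points, so it covers singletons as well as
   two-element sets. *)
have [Sx0|[y]] := set_0Vmem (S :\ x).
  have -> : S = [set x; x] by rewrite -(setD1K Sx) Sx0 setU0 setUid.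
  exact: pS.
rewrite !inE => /andP[yx Sy].
have [Sxy0|[z]] := set_0Vmem (S :\ x :\ y).
  have -> : S = [set x; y].
    by rewrite -(setD1K Sx) -(@setD1K _ y (S :\ x)) ?inE ?yx // Sxy0 setU0.
  exact: pS.
rewrite !inE => /and3P[zy zx Sz].
have DS1 u : u \in S -> S :\ u \in D.
  move=> Su; apply: IHn; first by rewrite (cardsD1 u S) Su in leSn.
  by move=> v w /setD1P[_ Sv] /setD1P[_ Sw]; apply: pS.
suff -> : S = ((S :\ x) :&: (S :\ y)) :|: ((S :\ x) :&: (S :\ z))
              :|: ((S :\ y) :&: (S :\ z)) by apply: medD; apply: DS1.
(* A point [u] of [S] equals at most one of the distinct [x], [y], [z], so it survives in at least
   two of the three sets. *)
apply/setP=> u; rewrite !inE; case: (u \in S); rewrite ?andbF // !andbT.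
have [->|ux] := eqVneq u x; first by rewrite !(eq_sym x) yx zx.
by have [->|uy] := eqVneq u y; rewrite // eq_sym zy.
Qed.

Lemma median_clique_complex (X : finType) (D : {set {set X}}) :
  is_complex D -> D != set0 -> median_property D ->
  exists H : graph_in X, clique_complex H = D.
Proof.
move=> cD /set0Pn[S0 DS0] medD.
have D0 : set0 \in D by apply: cD DS0 (sub0set _).
(* Points of [X] lying in no member of [D] must stay outside [V], since the singleton of every
   vertex is a clique. *)
pose V := [set u | [set u] \in D].
pose e : rel X := fun x y => (x != y) && ([set x; y] \in D).
have e_sym : symmetric e by move=> x y; rewrite /e eq_sym setUC.
have e_irr : irreflexive e by move=> x; rewrite /e eqxx.
have e_V x y : e x y -> (x \in V) && (y \in V).
  case/andP=> _ Dxy; rewrite !inE.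
  by rewrite !(cD _ _ Dxy) // sub1set !inE eqxx ?orbT.
exists (GraphIn e_sym e_irr e_V); apply/setP=> S; rewrite inE.
apply/cliqueP/idP => [cS | DS x y Sx Sy] /=.
  apply: median_pairwise => // x y Sx Sy.
  have /andP[/=] := cS x y Sx Sy; rewrite inE => Dx /orP[/eqP <-|/andP[]//].
  by rewrite setUid.
have Dxy : [set x; y] \in D by apply: cD DS _; rewrite subUset !sub1set Sx.
rewrite /e Dxy andbT orbN andbT inE.
by apply: cD DS _; rewrite sub1set.
Qed.

(** The complement is taken within [vertices H], not within [X], so that both graphs have the same
    vertex set. The two equations serve the two directions of passing between clique and
    independence representations. *)
Lemma compl_graph (X : finType) (H : graph_in X) :
  exists H' : graph_in X, clique_complex H' = independence_complex H
                       /\ independence_complex H' = clique_complex H.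
Proof.
pose V := vertices H.
pose e : rel X := fun x y => [&& x \in V, y \in V, x != y & ~~ adj H x y].
have e_sym : symmetric e.
  by move=> x y; rewrite /e eq_sym adj_sym andbCA.
have e_irr : irreflexive e by move=> x; rewrite /e eqxx !andbF.
have e_V x y : e x y -> (x \in V) && (y \in V) by case/and4P=> -> ->.
exists (GraphIn e_sym e_irr e_V).
split; apply/setP=> S; rewrite !inE /is_clique /is_independent /=;
  have [/subsetP sSV|//] := boolP (S \subset V);
  apply: eq_forallb_in => x Sx; apply: eq_forallb_in => y Sy;
  rewrite /e !sSV //=.
  (* For [x = y] the clique condition is vacuous, and the independence condition holds because [H]
     has no loops. *)
  by have [->|] := eqVneq x y; rewrite /= ?adj_irr.
by rewrite negb_and !negbK implyNb.
Qed.

Theorem theorem2 (X : finType) (Delta : {set {set X}})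
    (Delta_complex : is_complex Delta) (Delta_nonempty : Delta != set0) :
  ((exists H : graph_in X, clique_complex H = Delta)
     <-> median_property Delta)
  /\ ((exists H : graph_in X, independence_complex H = Delta)
     <-> median_property Delta).
Proof.
have clique_med : (exists H : graph_in X, clique_complex H = Delta)
                  <-> median_property Delta.
  split=> [[H <-]|]; first exact: clique_complex_median.
  exact: median_clique_complex.
split=> //; apply: iff_trans clique_med.
by split=> [][H <-]; have [H' [? ?]] := @compl_graph X H; exists H'.
Qed.
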